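(* Let $K$ be a $(d-1)$-dimensional cubical complex and $\mathrm{sd}_c(K)$ its cubical barycentric subdivision. Then for $i=0,\ldots,d-1$, \[ h^{(sc)}_i(\mathrm{sd}_c(K)) = \sum_{j=0}^{d-1} B(d,i,j)\, h^{(sc)}_j(K), \] where the coefficients $B(d,i,j)$ are nonnegative rational numbers determined by \[ \sum_{i=0}^{d-1} B(d,i,j)\,x^i = \frac{1}{2^{d-1}} (3x+1)^j (x+3)^{d-1-j}. \]
   Context: A cubical complex is a finite collection $K$ of polytopes in $\mathbb{R}^n$, each combinatorially isomorphic to a cube $[0,1]^m$, closed under taking faces and such that any two intersect in a common face; $f_j(K)$ is its number of $j$-dimensional faces. For a $(d-1)$-dimensional cubical complex $K$, the short cubical $h$-polynomial is $h^{(sc)}_K(x)=\sum_{i=0}^{d-1} h^{(sc)}_i(K)x^i = \sum_{j=0}^{d-1} f_j(K)(2x)^j(1-x)^{d-1-j}$, and $(h^{(sc)}_0(K),\ldots,h^{(sc)}_{d-1}(K))$ is the short cubical $h$-vector. The cubical barycentric subdivision $\mathrm{sd}_c(K)$ is the cubical complex whose vertices are the barycenters of the nonempty faces of $K$ and whose nonempty faces are, for each closed interval $[F,G]$ in the poset of nonempty faces of $K$ ordered by inclusion, the convex hull of the barycenters of the faces in $[F,G]$; it has the same dimension as $K$. *)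

(* Defs.v *)
From HB Require Import structures.
From mathcomp Require Import all_boot all_order all_algebra.
From mathcomp Require Import finmap.
From mathcomp Require Import mathcomp_extra boolp classical_sets functions.
From mathcomp Require Import cardinality reals.

Set Implicit Arguments.
Unset Strict Implicit.
Unset Printing Implicit Defensive.

Import Order.TTheory GRing.Theory Num.Theory.

Local Open Scope fset_scope.
Local Open Scope classical_set_scope.
Local Open Scope ring_scope.

Section Polytopes.
Context {R : realType}.

Definition dotv n (c x : 'rV[R]_n) : R := \sum_i c 0 i * x 0 i.

Definition conv n (S : {fset 'rV[R]_n}) : set 'rV[R]_n :=
  [set x | exists w : 'rV[R]_n -> R,
    [/\ forall s, s \in S -> 0 <= w s,
        \sum_(s <- S) w s = 1
      & x = \sum_(s <- S) w s *: s]].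

Definition polytope n (P : set 'rV[R]_n) : Prop :=
  exists S : {fset 'rV[R]_n}, P = conv S.

(* The nonempty faces of P, including P itself (take c = 0 and b = 0). *)
Definition faces n (P : set 'rV[R]_n) : set (set 'rV[R]_n) :=
  [set F | F !=set0 /\ exists (c : 'rV[R]_n) (b : R),
     (forall x, P x -> dotv c x <= b) /\ F = P `&` [set x | dotv c x = b]].

Definition cube m : set 'rV[R]_m := [set x | forall i, 0 <= x 0 i <= 1].

Definition vertices n (P : set 'rV[R]_n) : set 'rV[R]_n :=
  [set v | faces P [set v]].

(* The average of the vertices, not the center of mass of the solid P. *)
Definition barycenter n (P : set 'rV[R]_n) : 'rV[R]_n :=
  (#|` fset_set (vertices P)|)%:R^-1 *: \sum_(v <- fset_set (vertices P)) v.

End Polytopes.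

Arguments cube R m : clear implicits.

(* Isomorphism of two families of sets as posets ordered by inclusion. *)
Definition incl_iso (T U : Type) (A : set (set T)) (B : set (set U)) : Prop :=
  exists phi : set T -> set U, set_bij A B phi /\
    forall F G, A F -> A G -> (F `<=` G <-> phi F `<=` phi G).

Section CubicalComplexes.
Context {R : realType} {n : nat}.
Implicit Types K : {fset (set 'rV[R]_n)}.

(* Only nonempty faces are recorded in K; the empty face is left implicit. *)
Definition cubical_complex K : Prop :=
  [/\ forall P, P \in K ->
        polytope P /\ exists m, incl_iso (faces P) (faces (cube R m)),
      forall P F, P \in K -> faces P F -> F \in K
    & forall P Q, P \in K -> Q \in K -> P `&` Q !=set0 ->
        faces P (P `&` Q) /\ faces Q (P `&` Q)].

Definition cells_below K (F : set 'rV[R]_n) : set (set 'rV[R]_n) :=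
  [set G | G \in K /\ G `<=` F].

(* The m such that F, with the cells of K contained in it as its faces, is
   combinatorially isomorphic to [0,1]^m; m is unique when it exists, as
   [0,1]^m has 3^m nonempty faces. In a cubical complex the cells contained
   in F are exactly the faces of the polytope F, so m is its dimension. The
   faces are taken in the complex because the hulls of barycenters used in sdc
   below need not be flat when the cells of K are only combinatorial cubes: the
   hull for an interval [edge, 3-cube] can be a tetrahedron, which is
   nevertheless a 2-dimensional cell (a square) of the subdivision. *)
Definition cell_dim K (F : set 'rV[R]_n) : nat :=
  xget 0%N [set m | incl_iso (cells_below K F) (faces (cube R m))].

Definition complex_dim K : nat := \max_(F <- K) cell_dim K F.

Definition fnum K (j : nat) : nat := #|` [fset F in K | cell_dim K F == j]|.

(* With dim K = d - 1, the exponent d - 1 - j is complex_dim K - j. *)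
Definition hsc_poly K : {poly rat} :=
  \sum_(j < (complex_dim K).+1)
    (fnum K j)%:R *: ((2%:R *: 'X) ^+ j * (1 - 'X) ^+ (complex_dim K - j)).

Definition hsc K (i : nat) : rat := (hsc_poly K)`_i.

Definition sdc_cell K (F G : set 'rV[R]_n) : set 'rV[R]_n :=
  conv [fset barycenter H | H in [fset H in K | `[< F `<=` H /\ H `<=` G >]]].

Definition sdc K : {fset (set 'rV[R]_n)} :=
  [fset sdc_cell K p.1 p.2 | p in [fset p in (K `*` K)%fset | `[< p.1 `<=` p.2 >]]].

End CubicalComplexes.

Definition B_gen (d j : nat) : {poly rat} :=
  (2%:R ^+ d.-1)^-1 *: ((3%:R *: 'X + 1) ^+ j * ('X + 3%:R%:P) ^+ (d.-1 - j)).

Definition B (d i j : nat) : rat := (B_gen d j)`_i.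

(* Main.v *)
Require Import Defs.
From HB Require Import structures.
From mathcomp Require Import all_boot all_order all_algebra.
From mathcomp Require Import finmap.
From mathcomp Require Import mathcomp_extra boolp classical_sets functions.
From mathcomp Require Import cardinality reals.

Set Implicit Arguments.
Unset Strict Implicit.
Unset Printing Implicit Defensive.

Import Order.TTheory GRing.Theory Num.Theory.

Local Open Scope fset_scope.
Local Open Scope classical_set_scope.
Local Open Scope ring_scope.

(** The faces of [0,1]^m are the sign vectors s : 'I_m -> option bool, ordered
    by freeing coordinates. The barycenter of a cell lies in no proper face of
    it, so the hulls of barycenters of two intervals [F, G] and [F', G'] are
    nested exactly when the intervals are. If F corresponds to the sign vector
    s of a face of G, then [F, G] is a Boolean lattice on the support of s, and
    its subintervals form the face poset of a cube of dimension |supp s|. As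
    hsc_poly K is the sum of (2X)^(dim F) (1-X)^(D - dim F) over the cells F of
    K, where D = dim K, each m-dimensional G contributes to hsc_poly (sdc K)
      (1-X)^(D-m) \sum_s (2X)^|supp s| (1-X)^(m - |supp s|)
        = (1-X)^(D-m) (2 (2X) + (1-X))^m = (3X+1)^m (1-X)^(D-m).
    Homogenizing (2X)^m (1-X)^(D-m) at (3X+1, X+3) gives 2^D times the same
    polynomial. *)

(** * Convex hulls, polytopes and their faces *)

Section Convexity.
Context {R : realType} {n : nat}.
Implicit Types (S T : {fset 'rV[R]_n}) (P F : set 'rV[R]_n).

Lemma dotv_sum (I : Type) (r : seq I) (c : 'rV[R]_n) (w : I -> R)
    (v : I -> 'rV[R]_n) :
  dotv c (\sum_(i <- r) w i *: v i) = \sum_(i <- r) w i * dotv c (v i).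
Proof.
rewrite /dotv; under [RHS]eq_bigr do rewrite mulr_sumr.
rewrite exchange_big; apply: eq_bigr => k _.
rewrite summxE mulr_sumr; apply: eq_bigr => i _.
by rewrite mxE mulrCA.
Qed.

Lemma dotvN (c x : 'rV[R]_n) : dotv (- c) x = - dotv c x.
Proof.
by rewrite /dotv -sumrN; apply: eq_bigr => i _; rewrite mxE mulNr.
Qed.

Lemma dotvBr (c x y : 'rV[R]_n) : dotv c (x - y) = dotv c x - dotv c y.
Proof.
by rewrite /dotv -sumrB; apply: eq_bigr => i _; rewrite !mxE mulrBr.
Qed.

Lemma dotv_eq0 (x : 'rV[R]_n) : dotv x x = 0 -> x = 0.
Proof.
move=> /eqP; rewrite /dotv psumr_eq0 => [/allP x0|i _]; last first.
  by rewrite -expr2 sqr_ge0.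
apply/rowP => i; rewrite mxE; apply/eqP.
by have := x0 i (mem_index_enum _); rewrite /= mulf_eq0 orbb.
Qed.

Lemma conv_gen S s : s \in S -> conv S s.
Proof.
move=> sS; exists (fun t => (t == s)%:R); split => [t _||].
- by rewrite ler0n.
- rewrite (big_fsetD1 s) //= eqxx big1_fset ?addr0 // => t.
  by rewrite !inE => /andP[/negPf ->].
- rewrite (big_fsetD1 s) //= eqxx scale1r big1_fset ?addr0 // => t.
  by rewrite !inE => /andP[/negPf ->]; rewrite scale0r.
Qed.

Lemma conv_sub S T : (forall s, s \in S -> conv T s) -> conv S `<=` conv T.
Proof.
move=> ST x [w [w0 w1 ->]].
have /choice[W WP] s : exists W : 'rV[R]_n -> R, s \in S ->
    [/\ forall t, t \in T -> 0 <= W t, \sum_(t <- T) W t = 1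
      & s = \sum_(t <- T) W t *: t].
  have [sS|_] := boolP (s \in S); last by exists (fun=> 0).
  by have [W ?] := ST _ sS; exists W.
exists (fun t => \sum_(s <- S) w s * W s t); split.
- move=> t tT; rewrite big_seq; apply: sumr_ge0 => s sS.
  by have [W0 _ _] := WP _ sS; rewrite mulr_ge0 ?w0 ?W0.
- rewrite exchange_big -w1 big_seq [RHS]big_seq; apply: eq_bigr => s sS.
  by have [_ W1 _] := WP _ sS; rewrite -mulr_sumr W1 mulr1.
- under [RHS]eq_bigr do rewrite scaler_suml.
  rewrite exchange_big big_seq [RHS]big_seq; apply: eq_bigr => s sS.
  have [_ _ sE] := WP _ sS; rewrite [X in _ *: X = _]sE.
  by rewrite scaler_sumr; apply: eq_bigr => t _; rewrite scalerA.
Qed.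

Lemma polytope_conv P S :
  polytope P -> (forall s, s \in S -> P s) -> conv S `<=` P.
Proof. by move=> [T ->]; exact: conv_sub. Qed.

Lemma conv_mean S : S != fset0 -> conv S (#|` S|%:R^-1 *: \sum_(s <- S) s).
Proof.
move=> S0; have S1 : #|` S|%:R != 0 :> R by rewrite pnatr_eq0 cardfs_eq0.
exists (fun=> #|` S|%:R^-1); split => [s _||].
- by rewrite invr_ge0 ler0n.
- by rewrite big_const_seq count_predT iter_addr_0 -[LHS]mulr_natr mulVf.
- by rewrite scaler_sumr.
Qed.

(** A maximum over the finitely many generators bounds the functional on every convex
    combination. *)
Lemma polytope_argmax P (c : 'rV[R]_n) : polytope P -> P !=set0 ->
  exists2 x, P x & forall y, P y -> dotv c y <= dotv c x.
Proof.
move=> [S ->] [x [w [_ w1 _]]].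
have [S0|[s0 s0S]] := fset_0Vmem S.
  by move/eqP: w1; rewrite S0 big_seq_fset0 eq_sym oner_eq0.
have [/= s _ smax] :=
  @arg_maxP _ _ S [` s0S] xpredT (fun s => dotv c (val s)) isT.
exists (val s) => [|y [v [v0 v1 ->]]]; first exact/conv_gen/valP.
rewrite dotv_sum -[leRHS]mul1r -v1 mulr_suml big_seq [leRHS]big_seq.
apply: ler_sum => t tS; rewrite ler_wpM2l ?v0 //.
exact: (smax [` tS]).
Qed.

Lemma argmax_face P (c x : 'rV[R]_n) : P x ->
  (forall y, P y -> dotv c y <= dotv c x) ->
  faces P (P `&` [set y | dotv c y = dotv c x]).
Proof. by move=> Px xmax; split; [exists x|exists c, (dotv c x)]. Qed.

(* Faces are extreme: a linear functional at its maximum on a convex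
   combination is maximal on every point of positive weight. *)
Lemma face_extreme P F S (w : 'rV[R]_n -> R) : faces P F ->
  (forall s, s \in S -> P s) -> (forall s, s \in S -> 0 <= w s) ->
  \sum_(s <- S) w s = 1 -> F (\sum_(s <- S) w s *: s) ->
  forall s, s \in S -> w s != 0 -> F s.
Proof.
move=> [_ [c [b [cb ->]]]] SP w0 w1 [_ /= Eb] s sS ws0.
split; [exact: SP|apply/eqP; rewrite /= eq_le cb /=; last exact: SP].
have : \sum_(s <- S) w s * (b - dotv c s) = 0.
  under eq_bigr do rewrite mulrBr.
  by rewrite sumrB -mulr_suml w1 mul1r -dotv_sum Eb subrr.
rewrite big_seq => /eqP; rewrite psumr_eq0 => [/allP/(_ s sS)|t tS].
  by rewrite sS /= mulf_eq0 (negPf ws0) subr_eq0 => /eqP ->.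
by rewrite mulr_ge0 ?w0 // subr_ge0 cb //; exact: SP.
Qed.

End Convexity.

(** * Faces of cubes as sign vectors *)

Section CubeFaces.

(** [None] is a free coordinate and [Some b] one fixed at [b]. Read as a boolean, [s i] says that
    [i] is fixed; these [i] form the support of [s]. *)
Definition sign_vector (I : finType) := {ffun I -> option bool}.

(* [sign_le s t] says that [t] arises from [s] by freeing coordinates. *)
Definition sign_le (I : finType) (s t : sign_vector I) :=
  [forall i, (t i == None) || (t i == s i)].

Lemma sign_leP (I : finType) (s t : sign_vector I) :
  reflect (forall i b, t i = Some b -> s i = Some b) (sign_le s t).
Proof.
apply: (iffP forallP) => st i; last first.
  by case E : (t i) => [b|] //=; rewrite (st _ _ E).
by move=> b tib; have := st i; rewrite tib /= => /eqP <-.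
Qed.

Lemma sign_le_anti (I : finType) (s t : sign_vector I) :
  sign_le s t -> sign_le t s -> s = t.
Proof.
move=> /sign_leP st /sign_leP ts; apply/ffunP => i.
case E : (s i) => [b|]; first by rewrite (ts _ _ E).
by case E' : (t i) => [b|] //; rewrite (st _ _ E') in E.
Qed.

Context {R : realType}.

Definition cube_face m (s : sign_vector 'I_m) : set 'rV[R]_m :=
  [set x | cube R m x /\ forall i b, s i = Some b -> x 0 i = b%:R].

Lemma cube_face_le m (s t : sign_vector 'I_m) :
  cube_face s `<=` cube_face t <-> sign_le s t.
Proof.
split=> [st|/sign_leP st x [cx xs]]; last by split=> // i b /st/xs.
(* This point of [cube_face s] disagrees with [t] wherever [t] fixes a coordinate that [s] leaves
   free. *)
pose v i := odflt (~~ odflt true (t i)) (s i).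
have /st[_ vt] : cube_face s (\row_i (v i)%:R).
  split=> [i|i b sib]; rewrite mxE ?ler0n ?ler1n ?lern1 ?leq_b1 //.
  by rewrite /v sib.
apply/sign_leP => i b tib; have /eqP := vt i b tib.
rewrite mxE eqr_nat /v tib.
by case: (s i) => [[]|]; case: b {tib}.
Qed.

(** A functional on the cube is maximized coordinate by coordinate: at 1 where its coefficient is
    positive, at 0 where it is negative, anywhere where it is zero. *)
Lemma faces_cubeP m (F : set 'rV[R]_m) :
  faces (cube R m) F <-> exists s, F = cube_face s.
Proof.
split=> [[[x0 Fx0] [c [b [cb FE]]]]|[s ->]].
  pose s : sign_vector 'I_m :=
    [ffun i => if c 0 i == 0 then None else Some (0 < c 0 i)].
  pose top := \sum_i (if 0 < c 0 i then c 0 i else 0).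
  have gap x : cube R m x -> forall i,
      0 <= (if 0 < c 0 i then c 0 i else 0) - c 0 i * x 0 i.
    move=> cx i; have /andP[x0' x1] := cx i; rewrite subr_ge0; case: ltP => ci.
      by rewrite -[leRHS]mulr1 ler_wpM2l // ltW.
    exact: mulr_le0_ge0.
  have topE x : cube R m x -> (dotv c x = top <-> cube_face s x).
    move=> cx; split=> [/esym/eqP|[_ xs]]; last first.
      apply: eq_bigr => i _; have := xs i (0 < c 0 i); rewrite ffunE.
      case: eqP => [-> _|_ /(_ erefl) ->]; first by rewrite mul0r ltxx.
      by case: ltP; rewrite ?mulr1 ?mulr0.
    rewrite -subr_eq0 -sumrB psumr_eq0 => [/allP xs|i _]; last exact: gap.
    split=> // i d; rewrite ffunE; case: eqP => // /eqP ci0 [<-].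
    have := xs i (mem_index_enum _) => /=; case: ltP => _.
      by rewrite -{1}[c 0 i]mulr1 -mulrBr mulf_eq0 (negPf ci0) subr_eq0 => /eqP.
    by rewrite sub0r oppr_eq0 mulf_eq0 (negPf ci0) => /eqP.
  (* [b] is attained on the nonempty [F], hence at most [top], and it bounds the value [top] taken
     at the vertex [v]. *)
  have bE : b = top.
    apply/eqP; rewrite eq_le; apply/andP; split.
      move: Fx0; rewrite FE => -[cx0 <-].
      by rewrite -subr_ge0 -sumrB sumr_ge0 // => i _; exact: gap.
    pose v : 'rV[R]_m := \row_i (0 < c 0 i)%R%:R.
    have cv : cube R m v by move=> i; rewrite mxE ler0n lern1 leq_b1.
    have <- : dotv c v = top; last exact: cb.
    apply/topE => //; split=> // i d; rewrite ffunE mxE.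
    by case: eqP => // _ [<-].
  exists s; rewrite FE bE; apply/seteqP; split=> x.
    by move=> [cx /(topE _ cx)].
  by move=> sx; split; [exact: sx.1|apply/(topE _ sx.1)].
(* Conversely, coefficients 1, -1 and 0 at the coordinates fixed at 1, fixed at 0 and free give a
   functional that cuts out [cube_face s]. *)
pose sg (o : option bool) : R :=
  if o is Some b then (if b then 1 else -1) else 0.
pose top (o : option bool) : R := (o == Some true)%:R.
have gap x : cube R m x -> forall i, 0 <= top (s i) - sg (s i) * x 0 i.
  move=> cx i; have /andP[x0 x1] := cx i; rewrite /top /sg.
  case: (s i) => [[]|] /=; rewrite ?mul1r ?subr_ge0 ?mulN1r ?mul0r //.
  by rewrite oppr_le0.
pose c : 'rV[R]_m := \row_i sg (s i).
have cE x : \sum_i top (s i) - dotv c x =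
            \sum_i (top (s i) - sg (s i) * x 0 i).
  by rewrite /dotv -sumrB; apply: eq_bigr => i _; rewrite mxE.
split.
  exists (\row_i (odflt true (s i))%:R).
  split=> i; rewrite mxE ?ler0n ?lern1 ?leq_b1 //.
  by move=> b ->.
exists c, (\sum_i top (s i)); split=> [x cx|].
  by rewrite -subr_ge0 cE sumr_ge0 // => i _; exact: gap.
apply/seteqP; split=> x [cx xs]; split=> //=.
  apply/esym/eqP; rewrite -subr_eq0 cE big1 // => i _.
  rewrite /top /sg; case E : (s i) => [b|] /=; last by rewrite mul0r subrr.
  by rewrite (xs _ _ E); case: b {E}; rewrite ?mulr1 ?mulr0 subrr.
move=> i b sib; move: xs => /= /esym/eqP; rewrite -subr_eq0 cE psumr_eq0.
  move=> /allP/(_ i (mem_index_enum _)) /=; rewrite /top /sg sib /=.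
  case: b {sib} => /=; rewrite subr_eq0; first by rewrite mul1r => /eqP.
  by rewrite mulN1r eq_sym oppr_eq0 => /eqP.
by move=> j _; exact: gap.
Qed.

(** The index set is any finite type, so that the support of a sign vector can itself index the
    coordinates of a cube. *)
Definition cube_param (T : Type) (A : set (set T)) (I : finType)
    (f : sign_vector I -> set T) :=
  [/\ forall s, A (f s), forall X, A X -> exists s, f s = X
    & forall s t, f s `<=` f t <-> sign_le s t].

Lemma cube_param_inj (T : Type) (A : set (set T)) (I : finType)
  (f : sign_vector I -> set T) : cube_param A f -> injective f.
Proof.
by move=> [_ _ fle] s t st; apply: sign_le_anti; apply/fle; rewrite st.
Qed.

Lemma incl_iso_param (T : Type) (A : set (set T)) m :
  incl_iso A (faces (cube R m)) ->
  exists f : sign_vector 'I_m -> set T, cube_param A f.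
Proof.
move=> [phi [[phiA phi_inj phi_surj] phi_le]].
have /choice[f fP] s : exists X, A X /\ phi X = cube_face s.
  have [|X AX <-] := phi_surj (cube_face s).
    by apply/faces_cubeP; exists s.
  by exists X.
exists f; split=> [s|X AX|s t].
- by have [] := fP s.
- have /faces_cubeP[s sE] := phiA _ AX; exists s; have [Af fE] := fP s.
  by apply: phi_inj; rewrite ?inE ?fE.
- have [As sE] := fP s; have [At tE] := fP t.
  by apply: iff_trans (phi_le _ _ As At) _; rewrite sE tE; exact: cube_face_le.
Qed.

Lemma param_incl_iso (T : Type) (A : set (set T)) (I : finType)
  (f : sign_vector I -> set T) :
  cube_param A f -> incl_iso A (faces (cube R #|I|)).
Proof.
move=> fP; have f_inj := cube_param_inj fP; have [Af fA fle] := fP.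
pose mv (s : sign_vector I) : sign_vector 'I_#|I| := [ffun k => s (enum_val k)].
have mv_le s t : sign_le (mv s) (mv t) <-> sign_le s t.
  split=> /sign_leP st; apply/sign_leP => i b; last by rewrite !ffunE => /st.
  by have := st (enum_rank i) b; rewrite !ffunE enum_rankK.
pose g X := mv (xget [ffun=> None] [set s | f s = X]).
have gf s : g (f s) = mv s.
  by rewrite /g; case: xgetP => [t _ /f_inj ->|/(_ s)/(_ erefl)].
exists (fun X => cube_face (g X)); split=> [|X Y].
  split=> [X _|X Y|F /faces_cubeP[s ->]].
  - by apply/faces_cubeP; exists (g X).
  - rewrite !inE => /fA[s <-] /fA[t <-]; rewrite !gf => E.
    congr f; apply: sign_le_anti; apply/mv_le/cube_face_le; rewrite E;
    exact: subset_refl.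
  - exists (f [ffun i => s (enum_rank i)]) => //; rewrite gf; congr cube_face.
    by apply/ffunP => k; rewrite !ffunE enum_valK.
move=> /fA[s <-] /fA[t <-]; rewrite !gf.
by rewrite fle cube_face_le mv_le.
Qed.

Lemma card_sign_vector (I : finType) : #|sign_vector I| = (3 ^ #|I|)%N.
Proof. by rewrite card_ffun card_option card_bool. Qed.

Lemma cube_param_leq (T : Type) (A : set (set T)) (I J : finType)
  (f : sign_vector I -> set T) (g : sign_vector J -> set T) :
  cube_param A f -> cube_param A g -> (#|I| <= #|J|)%N.
Proof.
move=> fP [_ gA _]; have f_inj := cube_param_inj fP; have [Af _ _] := fP.
have /choice[h hP] s : exists t, g t = f s := gA _ (Af s).
have /leq_card : injective h by move=> s t st; apply: f_inj; rewrite -!hP st.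
by rewrite !card_sign_vector leq_exp2l.
Qed.

(** The value [#|I|] qualifies in the choice defining [cell_dim], so the default 0 is not taken, and
    counting sign vectors makes any chosen value equal to it. *)
Lemma cell_dim_param n (K : {fset (set 'rV[R]_n)}) F (I : finType)
  (f : sign_vector I -> set 'rV[R]_n) :
  cube_param (cells_below K F) f -> cell_dim K F = #|I|.
Proof.
move=> fP; rewrite /cell_dim; case: xgetP => [m _ /incl_iso_param[g gP]|].
  have := cube_param_leq fP gP; have := cube_param_leq gP fP.
  by rewrite card_ord => mI Im; apply/eqP; rewrite eqn_leq mI Im.
by move=> /(_ #|I|); have := param_incl_iso fP.
Qed.

End CubeFaces.

(** * Cells, vertices and barycenters of a cubical complex *)

Section Complex.
Context {R : realType} {n : nat} (K : {fset (set 'rV[R]_n)})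
  (cubK : cubical_complex K).

Lemma cell_polytope P : P \in K -> polytope P.
Proof. by have [cellK _ _] := cubK => /cellK[]. Qed.

Lemma face_cell P F : P \in K -> faces P F -> F \in K.
Proof. by have [_ faceK _] := cubK; exact: faceK. Qed.

(** A cell has as many faces as a cube, hence at least one, and faces are nonempty. *)
Lemma cell_neq0 P : P \in K -> P !=set0.
Proof.
have [cellK _ _] := cubK => /cellK[_ [m /incl_iso_param[f [fP _ _]]]].
have [[x Fx] [c [b [_ FE]]]] := fP [ffun=> None].
by move: Fx; rewrite FE => -[Px _]; exists x.
Qed.

Lemma cell_face P Q : P \in K -> Q \in K -> Q `<=` P -> faces P Q.
Proof.
have [_ _ interK] := cubK => PK QK QP; have PQ := setIidr QP.
by have [|] := interK _ _ PK QK; rewrite PQ //; exact: cell_neq0.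
Qed.

Lemma face_sub (P F : set 'rV[R]_n) : faces P F -> F `<=` P.
Proof. by move=> [_ [c [b [_ ->]]]] x []. Qed.

Lemma cells_belowE P : P \in K -> cells_below K P = faces P.
Proof.
move=> PK; apply/seteqP; split=> F; first by move=> []; exact: cell_face.
by move=> PF; split; [exact: face_cell PF|exact: face_sub].
Qed.

Lemma cell_param P : P \in K ->
  exists f : sign_vector 'I_(cell_dim K P) -> set 'rV[R]_n,
    cube_param (cells_below K P) f.
Proof.
have [cellK _ _] := cubK => PK; have [_ [m]] := cellK _ PK.
rewrite -cells_belowE // => /incl_iso_param[f fP].
by rewrite (cell_dim_param fP) card_ord; exists f.
Qed.

(** Induction on the number of cells contained in [F]. If [F] has two points [x] and [y], the face
    maximizing [x - y] is proper, as the values at [x] and [y] differ by the squared length of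
    [x - y]. *)
Lemma cell_vertex F : F \in K -> exists2 v, F v & [set v] \in K.
Proof.
have [k] := ubnP #|` [fset G in K | `[< G `<=` F >]]|.
elim: k F => // k IH F; rewrite ltnS => Fk FK.
have [x Fx] := cell_neq0 FK.
have [Fx1|Fx1] := pselect (F = [set x]); first by exists x; rewrite // -Fx1.
have [y Fy yx] : exists2 y, F y & y != x.
  apply: contrapT => /forall2NP xF; apply: Fx1; apply/seteqP.
  split=> [y Fy|y ->//]; have [//|/negP] := xF y.
  by rewrite negbK => /eqP.
have [z Fz zmax] := polytope_argmax (x - y) (cell_polytope FK) (cell_neq0 FK).
have := argmax_face Fz zmax; set G := _ `&` _ => FG.
have GK := face_cell FK FG; have GF := face_sub FG.
have [||v Gv vK] := IH G => //; last by exists v => //; exact: GF.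
apply: leq_trans Fk; apply: fproper_ltn_card; rewrite fproperE; apply/andP.
split; apply/fsubsetP.
  move=> H; rewrite !inE /= => /andP[-> /asboolP HG] /=; apply/asboolP.
  exact: subset_trans GF.
move=> /(_ F); rewrite !inE /= FK /= => FG'.
have FsubG : F `<=` G by apply/asboolP/FG'/asboolP.
have [_ xz] := FsubG _ Fx; have [_ yz] := FsubG _ Fy.
have /eqP : x - y = 0 by apply: dotv_eq0; rewrite dotvBr xz yz subrr.
by rewrite subr_eq0 eq_sym (negPf yx).
Qed.

(** Each vertex is recovered from its singleton, one of the finitely many cells. Finiteness is what
    makes [fset_set] in [barycenter] list the actual vertices. *)
Lemma finite_vertices P : P \in K -> finite_set (vertices P).
Proof.
move=> PK; apply: (@sub_finite_set _ _ ((fun F => xget 0 F) @` [set` K])).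
  move=> v /(face_cell PK) vK; exists [set v] => //.
  by case: xgetP => [w _ ->|/(_ v)/(_ erefl)].
exact/finite_image/finite_fset.
Qed.

Lemma mem_vertices P v : P \in K ->
  (v \in fset_set (vertices P)) = (v \in vertices P).
Proof. by move=> PK; rewrite in_fset_set //; exact: finite_vertices. Qed.

Lemma vertices_neq0 P : P \in K -> fset_set (vertices P) != fset0.
Proof.
move=> PK; have [v Pv vK] := cell_vertex PK; apply/fset0Pn; exists v.
by rewrite mem_vertices // inE; apply: cell_face => // _ ->.
Qed.

Lemma vertex_in P v : P \in K -> v \in fset_set (vertices P) -> P v.
Proof. by move=> PK; rewrite mem_vertices // inE => /face_sub; exact. Qed.

Lemma barycenter_in P : P \in K -> P (barycenter P).
Proof.
move=> PK.
apply: (polytope_conv (cell_polytope PK)) (conv_mean (vertices_neq0 PK)).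
by move=> v; exact: vertex_in.
Qed.

(* A face through the barycenter contains every vertex of [P]; if it were
   proper, the opposite face, where its functional is minimal, would be
   disjoint from it and yet contain a vertex. *)
Lemma barycenter_face P F : P \in K -> faces P F -> F (barycenter P) -> F = P.
Proof.
move=> PK PF; set V := fset_set (vertices P).
have V1 : #|` V|%:R != 0 :> R by rewrite pnatr_eq0 cardfs_eq0 vertices_neq0.
rewrite /barycenter scaler_sumr => Fb.
have VF v : v \in V -> F v.
  move=> vV; apply: (face_extreme PF _ _ _ Fb vV); rewrite ?invr_eq0 //.
  - by move=> s; exact: vertex_in.
  - by move=> s _; rewrite invr_ge0 ler0n.
  - by rewrite big_const_seq count_predT iter_addr_0 -[LHS]mulr_natr mulVf.
have [_ [c [b [cb FE]]]] := PF.
apply/seteqP; split=> [|x Px]; first exact: face_sub.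
have [z Pz zmin] := polytope_argmax (- c) (cell_polytope PK) (cell_neq0 PK).
have PG := argmax_face Pz zmin.
have [v Gv vK] := cell_vertex (face_cell PK PG).
have : F v.
  apply: VF; rewrite mem_vertices // inE; apply: cell_face => // _ ->.
  exact: face_sub PG _ Gv.
rewrite FE => -[_ /= cv]; split=> //=; apply/eqP; rewrite eq_le cb //=.
have := zmin _ Px; have [_ /= <-] := Gv.
by rewrite !dotvN lerN2 cv.
Qed.

(** The face that [Q] cuts out on [P] contains the barycenter of [P], so it is all of [P]. *)
Lemma barycenter_sub P Q : P \in K -> Q \in K -> Q (barycenter P) -> P `<=` Q.
Proof.
have [_ _ interK] := cubK => PK QK Qb; have Pb := barycenter_in PK.
have [|PPQ _] := interK _ _ PK QK; first by exists (barycenter P).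
by rewrite -(barycenter_face PK PPQ) // => x [].
Qed.

(** * Cells of the subdivision and their order *)

Lemma sdc_cell_sub F G : G \in K -> sdc_cell K F G `<=` G.
Proof.
move=> GK; apply: (polytope_conv (cell_polytope GK)) => s.
move=> /imfsetP[H]; rewrite !inE /= => /andP[HK /asboolP[_ HG]] ->.
exact: HG (barycenter_in HK).
Qed.

Lemma sdc_cell_barycenter F G H : H \in K -> F `<=` H -> H `<=` G ->
  sdc_cell K F G (barycenter H).
Proof.
move=> HK FH HG; apply/conv_gen/imfsetP; exists H => //.
by rewrite !inE HK /=; apply/asboolP.
Qed.

(** From left to right, the barycenter of [G] lies in [G'], hence so does [G]. The barycenter of [F]
    is a convex combination of barycenters of cells [H] containing [F']. As [F] is a face of [G'],
    one of nonzero weight lies in [F], and then [F'] is inside [H] and [H] inside [F]. *)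
Lemma sdc_cell_le F G F' G' : F \in K -> G \in K -> F' \in K -> G' \in K ->
  F `<=` G -> F' `<=` G' ->
  (sdc_cell K F G `<=` sdc_cell K F' G' <-> F' `<=` F /\ G `<=` G').
Proof.
move=> FK GK F'K G'K FG F'G'; split=> [sub|[F'F GG']]; last first.
  apply: conv_sub => s /imfsetP[H].
  rewrite !inE /= => /andP[HK /asboolP[FH HG]] ->.
  by apply: sdc_cell_barycenter HK _ _;
    [exact: subset_trans FH|exact: subset_trans GG'].
have GG' : G `<=` G'.
  apply: barycenter_sub => //; apply: (sdc_cell_sub G'K); apply: sub.
  exact: sdc_cell_barycenter.
split=> //.
have [w [w0 w1 bE]] := sub _ (sdc_cell_barycenter FK (@subset_refl _ _) FG).
have G'F : faces G' F by apply: cell_face => //; exact: subset_trans GG'.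
set S := [fset _ | _ in _]%fset in w0 w1 bE.
have [/hasP[s sS ws]|/hasPn w_eq0] := boolP (has (fun s => w s != 0) S);
  last first.
  move/eqP: w1; rewrite big_seq big1 ?[0 == _]eq_sym ?oner_eq0 // => s.
  by move=> /w_eq0; rewrite negbK => /eqP.
have SG' t : t \in S -> G' t.
  by move=> tS; apply: (@sdc_cell_sub F'); last exact: conv_gen.
have : F s.
  apply: (face_extreme G'F SG' w0 w1 _ sS ws).
  by rewrite -bE; exact: barycenter_in.
move: sS => /imfsetP[H]; rewrite !inE /= => /andP[HK /asboolP[F'H _]] -> Fb.
exact: subset_trans F'H (barycenter_sub HK FK Fb).
Qed.

Lemma sdc_cell_inj F G F' G' : F \in K -> G \in K -> F' \in K -> G' \in K ->
  F `<=` G -> F' `<=` G' ->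
  sdc_cell K F G = sdc_cell K F' G' -> F = F' /\ G = G'.
Proof.
move=> FK GK F'K G'K FG F'G' E.
have [|F'F GG'] := (sdc_cell_le FK GK F'K G'K FG F'G').1; rewrite ?E //.
have [|FF' G'G] := (sdc_cell_le F'K G'K FK GK F'G' FG).1; rewrite ?E //.
by split; apply/seteqP.
Qed.

Lemma sdcP C : reflect
  (exists F G, [/\ F \in K, G \in K, F `<=` G & C = sdc_cell K F G])
  (C \in sdc K).
Proof.
rewrite /sdc.
apply: (iffP (imfsetP _ _ _ _)) => [[[F G]]|[F [G [FK GK FG ->]]]].
  by rewrite !inE /= => /andP[/andP[FK GK] /asboolP FG] ->; exists F, G.
by exists (F, G); rewrite // !inE /= FK GK /=; apply/asboolP.
Qed.

(* An interval [F, G] with [F] corresponding to the sign vector [s] is a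
   Boolean lattice on the support of [s]; a subinterval is a sign vector [u]
   on that support, recording which coordinates are released in its bottom
   ([Some false]), fixed in its top ([Some true]), or neither ([None]). *)
Lemma cell_dim_sdc G (I : finType) (f : sign_vector I -> set 'rV[R]_n) s :
  G \in K -> cube_param (cells_below K G) f ->
  cell_dim (sdc K) (sdc_cell K (f s) G) = #|[pred i | s i]|.
Proof.
move=> GK [fK fsurj fle].
(* The value chosen off the support is harmless: those coordinates are already free in [s]. *)
pose ext (u : sign_vector {i | s i}) i := oapp u None (insub i).
pose bot u : sign_vector I :=
  [ffun i => if ext u i == Some false then None else s i].
pose top u : sign_vector I :=
  [ffun i => if ext u i == Some true then s i else None].
have s_bot u : sign_le s (bot u).
  by apply/sign_leP => i b; rewrite ffunE; case: ifP.
have bot_top u : sign_le (bot u) (top u).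
  by apply/sign_leP => i b; rewrite !ffunE; case: eqP => // ->.
have fKK t : f t \in K by have [] := fK t.
have fG t : f t `<=` G by have [] := fK t.
rewrite -card_sig.
apply: (@cell_dim_param _ _ _ _ _
  (fun u => sdc_cell K (f (bot u)) (f (top u)))).
split=> [u|X|u v].
- split.
    by apply/sdcP; exists (f (bot u)), (f (top u)); split; rewrite // fle.
  apply/sdc_cell_le => //; first by apply/fle.
  by split=> //; apply/fle.
- move=> [/sdcP[F' [G' [F'K G'K F'G' ->]]] /sdc_cell_le[] // sF' G'G].
  have [s' s'E] : exists s', f s' = F'.
    by apply: fsurj; split=> //; exact: subset_trans G'G.
  have [t' t'E] : exists t', f t' = G' by apply: fsurj.
  subst F' G'; move/fle/sign_leP: sF' => ss'; move/fle/sign_leP: F'G' => st'.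
  (* On the support, a coordinate of the subinterval from [s'] to [t'] is fixed at both ends, fixed
     only at the bottom, or free at both. *)
  exists [ffun j => if t' (val j) then Some true else
                    if s' (val j) then None else Some false].
  congr (sdc_cell K (f _) (f _)); apply/ffunP => i; rewrite ffunE /ext.
    case: insubP => [j _ <-|]; rewrite /= ?ffunE.
      case Et : (t' (val j)) => [b|].
        by rewrite (st' _ _ Et) (ss' _ _ (st' _ _ Et)).
      by case Es : (s' (val j)) => [b|] //=; rewrite (ss' _ _ Es).
    by case Es : (s' i) => [b|]; rewrite ?(ss' _ _ Es) //; case: (s i).
  case: insubP => [j _ <-|]; rewrite /= ?ffunE.
    case Et : (t' (val j)) => [b|]; first by rewrite (ss' _ _ (st' _ _ Et)).
    by case: (s' _).
  by case Et : (t' i) => [b|]; rewrite ?(ss' _ _ (st' _ _ Et)).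
(* Where [v] is [Some false], comparing bottoms forces the same value on [u]; where it is
   [Some true], comparing tops does. *)
- rewrite sdc_cell_le ?fle //; split=> [[/sign_leP bots /sign_leP tops]|uv].
    apply/sign_leP => j; have sj := valP j.
    have := bots (val j); have := tops (val j); rewrite !ffunE /ext valK /=.
    case: (s (val j)) sj => // a _ tb bb [] vj; move: tb bb; rewrite vj /=.
      by move=> /(_ a erefl); case: eqP.
    by move=> _; case: eqP => // _ /(_ a erefl).
  split; apply/sign_leP => i b; rewrite !ffunE /ext;
    case: insubP => [j _ <-|] //=.
    by move: uv => /sign_leP/(_ j); case: (v j) => [[]|] //=
      => [/(_ _ erefl) ->|/(_ _ erefl) ->|_] //; case: ifP.
  by move: uv => /sign_leP/(_ j); case: (v j) => [[]|] //= => /(_ _ erefl) ->.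
Qed.

End Complex.

(** * Short cubical h-polynomials as sums over cells *)

Section HPolynomial.
Context {R : realType} {n : nat}.
Implicit Types K : {fset (set 'rV[R]_n)}.

Lemma cell_dim_max K F : F \in K -> (cell_dim K F <= complex_dim K)%N.
Proof. by move=> FK; rewrite /complex_dim; apply: leq_bigmax_seq. Qed.

Lemma hsc_poly_cells K : hsc_poly K =
  \sum_(F <- K) (2%:R *: 'X) ^+ cell_dim K F *
                (1 - 'X) ^+ (complex_dim K - cell_dim K F).
Proof.
rewrite /hsc_poly; set D := complex_dim K.
pose g j : {poly rat} := (2%:R *: 'X) ^+ j * (1 - 'X) ^+ (D - j).
rewrite -/(g _) [RHS]big_seq.
under [RHS]eq_bigr => F FK.
  have FD : (cell_dim K F < D.+1)%N by rewrite ltnS cell_dim_max.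
  rewrite -/(g (cell_dim K F)).
  (* Spreading each cell over all dimensions by an indicator allows the two sums to be exchanged. *)
  have -> : g (cell_dim K F) =
      \sum_(j < D.+1) (cell_dim K F == j)%:R *: g j.
    rewrite (bigD1 (Ordinal FD)) //= eqxx scale1r big1 ?addr0 // => j jF.
    by rewrite eq_sym -val_eqE /= in jF; rewrite (negPf jF) scale0r.
  over.
rewrite /= -big_seq exchange_big; apply: eq_bigr => j _.
rewrite -scaler_suml; congr (_ *: _).
rewrite /fnum card_fset_sum1 -natr_sum -big_fset_condE /=; congr (_%:R).
by rewrite big_mkcond; apply: eq_bigr => F _; case: eqP.
Qed.

(** A cell of the subdivision determines its interval, and the bottom is the face of the top given
    by a unique sign vector, so nothing is listed twice. *)
Lemma sdc_cells K (cubK : cubical_complex K)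
    (f : forall G, sign_vector 'I_(cell_dim K G) -> set 'rV[R]_n) :
    (forall G, G \in K -> cube_param (cells_below K G) (f G)) ->
  perm_eq (sdc K)
    [seq sdc_cell K (f G s) G
       | G <- K, s <- index_enum (sign_vector 'I_(cell_dim K G))].
Proof.
move=> fP.
have fK G s : G \in K -> f G s \in K by move=> /fP[/(_ s)[]].
have fG G s : G \in K -> f G s `<=` G by move=> /fP[/(_ s)[]].
apply: uniq_perm; first exact: fset_uniq.
  apply: allpairs_uniq_dep => [|G _|].
  - exact: fset_uniq.
  - exact: index_enum_uniq.
  move=> _ _ /allpairsPdep[G [s [GK _ ->]]] /allpairsPdep[H [t [HK _ ->]]] /=.
  move=> E; have [E1 E2] := sdc_cell_inj cubK (fK _ s GK) GK (fK _ t HK) HK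
    (fG _ s GK) (fG _ t HK) E.
  subst H; congr existT; apply: (cube_param_inj (fP _ GK)); exact: E1.
move=> C; apply/(sdcP K)/allpairsPdep => [[F [G [FK GK FG ->]]]|].
  have [_ fsurj _] := fP _ GK; have [s sF] := fsurj _ (conj FK FG).
  by exists G, s; rewrite mem_index_enum sF.
move=> [G [s [GK _ ->]]]; exists (f G s), G; split=> //; [exact: fK|exact: fG].
Qed.

Lemma complex_params K : cubical_complex K ->
  exists f : forall G, sign_vector 'I_(cell_dim K G) -> set 'rV[R]_n,
    forall G, G \in K -> cube_param (cells_below K G) (f G).
Proof.
move=> cubK.
have ex G : exists f : sign_vector 'I_(cell_dim K G) -> set 'rV[R]_n,
    G \in K -> cube_param (cells_below K G) f.
  have [GK|_] := boolP (G \in K); last by exists (fun=> set0).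
  by have [f fP] := cell_param cubK GK; exists f.
(* The type of [f G] depends on [G], hence the pointwise choice by [cid]. *)
by exists (fun G => projT1 (cid (ex G))) => G; exact: (projT2 (cid (ex G))).
Qed.

(** Among the intervals with top [G] the largest dimension is that of [G], attained at a sign vector
    fixing every coordinate. *)
Lemma complex_dim_sdc K : cubical_complex K ->
  complex_dim (sdc K) = complex_dim K.
Proof.
move=> cubK; have [f fP] := complex_params cubK.
rewrite /complex_dim (perm_big _ (sdc_cells cubK fP)) big_allpairs_dep /=.
rewrite big_seq [RHS]big_seq; apply: eq_bigr => G GK.
under eq_bigr do rewrite (cell_dim_sdc cubK _ GK (fP G GK)).
apply/eqP; rewrite eqn_leq; apply/andP; split.
  by apply/bigmax_leqP => s _; rewrite (leq_trans (max_card _)) ?card_ord.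
rewrite -{1}(card_ord (cell_dim K G)).
apply: leq_trans (leq_bigmax ([ffun=> Some true] : sign_vector _)).
by apply: eq_leq; apply: eq_card => i; rewrite !inE ffunE.
Qed.

(** Expand a product over the coordinates: each is fixed in two ways of weight [y], or free with
    weight [z]. *)
Lemma sum_sign_vector (A : comPzRingType) m (y z : A) :
  \sum_(s : sign_vector 'I_m)
    y ^+ #|[pred i | s i]| * z ^+ (m - #|[pred i | s i]|) = (y *+ 2 + z) ^+ m.
Proof.
transitivity (\prod_(i < m) \sum_(o : option bool) if o then y else z).
  rewrite bigA_distr_bigA; apply: eq_bigr => s _.
  rewrite (bigID [pred i | s i]) /=.
  rewrite (eq_bigr (fun=> y)) => [|i ->//].
  rewrite [X in _ = _ * X](eq_bigr (fun=> z)) => [|i /negPf ->//].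
  rewrite !prodr_const; congr (_ * _ ^+ _).
  by rewrite -{1}[m]card_ord -(cardC [pred i | s i]) addKn; apply: eq_card.
rewrite prodr_const card_ord; congr (_ ^+ _).
rewrite (bigD1 None) //= (bigD1 (Some true)) //= (bigD1 (Some false)) //=.
by rewrite big1 ?addr0 => [|[[]|]//]; rewrite mulr2n addrC.
Qed.

Lemma hsc_poly_sdc K : cubical_complex K -> hsc_poly (sdc K) =
  \sum_(F <- K) (3%:R *: 'X + 1) ^+ cell_dim K F *
                (1 - 'X) ^+ (complex_dim K - cell_dim K F).
Proof.
move=> cubK; have [f fP] := complex_params cubK.
rewrite hsc_poly_cells complex_dim_sdc //.
rewrite (perm_big _ (sdc_cells cubK fP)) big_allpairs_dep /=.
rewrite big_seq [RHS]big_seq; apply: eq_bigr => G GK.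
have -> : 3%:R *: 'X + 1 = (2%:R *: 'X) *+ 2 + (1 - 'X) :> {poly rat}.
  rewrite -scaler_nat scalerA addrCA addrC -[- 'X]scaleN1r -scalerDl.
  by congr (_ *: _ + _).
rewrite -sum_sign_vector mulr_suml; apply: eq_bigr => s _.
rewrite (cell_dim_sdc cubK _ GK (fP G GK)) -mulrA -exprD; congr (_ * _ ^+ _).
(* With m = dim G, the exponents m - |supp s| and D - m add up to D - |supp s|, as |supp s| <= m <=
   D. *)
rewrite addnC addnBA ?subnK ?cell_dim_max //.
by rewrite (leq_trans (max_card _)) ?card_ord.
Qed.

End HPolynomial.

(** * Homogenization of polynomials *)

Section Homogenization.
Context {A : comNzRingType}.

Lemma coef_exp1subX k i :
  ((1 - 'X) ^+ k : {poly A})`_i = (-1) ^+ i *+ 'C(k, i).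
Proof.
have -> : (1 - 'X) ^+ k = \poly_(i < k.+1) ((-1) ^+ i *+ 'C(k, i)) :> {poly A}.
  rewrite exprBn poly_def; apply: eq_bigr => j _.
  rewrite expr1n mulr1 -scalerMnl -[in RHS]signr_odd scaler_sign.
  by rewrite -signr_odd mulr_sign.
by rewrite coef_poly; case: ltnP => // ki; rewrite bin_small.
Qed.

(** Formally, the sum is b^(m+k) p(a/b) for p = (cX)^m (1-X)^k. Coefficients of p below degree m
    vanish, and the others come from the binomial expansion of (1-X)^k. *)
Lemma homogenize_term (a b : {poly A}) (c : A) m k :
  \sum_(j < (m + k).+1)
     ((c *: 'X) ^+ m * (1 - 'X) ^+ k)`_j *: (a ^+ j * b ^+ (m + k - j))
  = (c *: a) ^+ m * (b - a) ^+ k.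
Proof.
rewrite exprZn -scalerAl -addnS big_split_ord /=.
rewrite big1 ?add0r => [|j _]; last first.
  by rewrite coefZ coefXnM ltn_ord mulr0 scale0r.
rewrite exprZn -scalerAl [(b - a) ^+ k]exprBn mulr_sumr scaler_sumr.
apply: eq_bigr => i _; rewrite coefZ coefXnM ltnNge leq_addr /= addKn coef_exp1subX.
rewrite -scalerA; congr (_ *: _).
rewrite subnDl exprD -scalerMnl mulrnAr; congr (_ *+ _).
rewrite -[in LHS]signr_odd scaler_sign -[in RHS]signr_odd.
rewrite -[in RHS]mulrA mulr_sign.
by rewrite -mulrA [b ^+ _ * _]mulrC; case: odd; rewrite // mulrN.
Qed.

End Homogenization.

(** * Transformation of the short cubical h-vector *)

Theorem theorem3p2 (R : realType) (n d : nat) (K : {fset (set 'rV[R]_n)})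
  (cubK : cubical_complex K) (K_neq0 : K != fset0)
  (dimK : d = (complex_dim K).+1) :
  [/\ forall i j : 'I_d, 0 <= B d i j,
      forall j : 'I_d,
        \sum_(i < d) B d i j *: 'X^i =
          (2%:R ^+ d.-1)^-1 *:
            ((3%:R *: 'X + 1) ^+ j * ('X + 3%:R%:P) ^+ (d.-1 - j)) :> {poly rat}
    & forall i : 'I_d,
        hsc (sdc K) i = \sum_(j < d) B d i j * hsc K j].
Proof.
subst d; set D := complex_dim K; split.
- move=> i j; suff /polyOverP/(_ i) : B_gen D.+1 j \is a polyOver Num.nneg.
    by rewrite nnegrE.
  by rewrite /B_gen polyOverZ ?rpredM ?rpredX ?rpredD ?polyOverZ ?polyOverX
    ?rpred1 // ?polyOverC ?nnegrE ?invr_ge0 ?exprn_ge0 //.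
- move=> j; rewrite -/(B_gen D.+1 j) -poly_def.
  apply/polyP => i; rewrite coef_poly; case: ltnP => // Di.
  (* The degree of [B_gen] is at most j + (D - j) = D, so truncation at [d] loses nothing. *)
  rewrite nth_default //; apply: leq_trans Di.
  rewrite (leq_trans (size_scale_leq _ _)) // (leq_trans (size_mul_leq _ _)) //.
  have s1 : (size (3%:R *: 'X + 1 : {poly rat})%R <= 2)%N.
    rewrite (leq_trans (size_polyD _ _)) // geq_max size_poly1 andbT.
    by rewrite (leq_trans (size_scale_leq _ _)) ?size_polyX.
  have s2 : (size ('X + 3%:R%:P : {poly rat})%R <= 2)%N.
    by rewrite size_XaddC.
  have sX (p : {poly rat}) k : (size p <= 2)%N -> (size (p ^+ k)%R <= k.+1)%N.
    move=> p2; rewrite (leq_trans (size_poly_exp_leq _ _)) // ltnS.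
    by case: (size p) p2 => [|[|[|]]] //= _; rewrite ?mul0n ?mul1n.
  rewrite -subn1 leq_subLR (leq_trans (leq_add (sX _ _ s1) (sX _ _ s2))) //.
  by rewrite addSn addnS subnKC // -ltnS.
- move=> i; rewrite [LHS]/hsc.
  suff -> : hsc_poly (sdc K) = \sum_(j < D.+1) hsc K j *: B_gen D.+1 j.
    by rewrite coef_sum; apply: eq_bigr => j _; rewrite coefZ mulrC.
  rewrite hsc_poly_sdc // /hsc hsc_poly_cells -/D.
  (* Both sides become sums over the cells [F] of [K], compared term by term. *)
  under [RHS]eq_bigr do rewrite coef_sum scaler_suml.
  rewrite exchange_big big_seq [RHS]big_seq; apply: eq_bigr => F FK.
  have /subnKC := cell_dim_max FK; rewrite -/D.
  set m := cell_dim K F; set k := (D - m)%N => mk.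
  rewrite -mk /B_gen /=; under [RHS]eq_bigr do rewrite scalerA mulrC -scalerA.
  rewrite -scaler_sumr homogenize_term.
  (* This is b - a for a = 3X+1 and b = X+3. Its factor 2 to the power k and the factor 2^m from
     (2a)^m together cancel the denominator 2^D. *)
  have -> : 'X + 3%:R%:P - (3%:R *: 'X + 1) = 2%:R *: (1 - 'X) :> {poly rat}.
    rewrite scalerBr -[2%:R *: 1]/(2%:R%:A) alg_polyC opprD addrACA addrC.
    congr (_ + _).
      by rewrite -polyC1 -polyCN -polyCD; congr (_%:P).
    by rewrite -[X in X - _]scale1r -scalerBl -scaleNr; congr (_ *: _).
  rewrite !exprZn -scalerAl -scalerAr !scalerA exprD -mulrA.
  by rewrite mulVf ?scale1r // mulf_neq0 ?expf_neq0.
Qed.
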